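(* Let $M$ be a smooth manifold endowed with a contact pair structure $(\alpha_1,\alpha_2,\phi)$ with Reeb vector fields $Z_1,Z_2$. Let $g$ be a Riemannian metric on $M$ compatible with respect to $(\alpha_1,\alpha_2,\phi)$, with Levi-Civita connection $\nabla$. Then: (1) $g(Z_i,X)=\alpha_i(X)$ for $i=1,2$ and every $X\in\Gamma(TM)$; (2) $g(Z_i,Z_j)=\delta_i^j$ for $i,j=1,2$; (3) $\nabla_{Z_i}Z_j=0$ for $i,j=1,2$ (in particular the integral curves of the Reeb vector fields are geodesics); (4) the Reeb action is totally geodesic, i.e. its orbits are totally geodesic $2$-dimensional submanifolds of $(M,g)$. Moreover, if $g$ is an associated metric with respect to $(\alpha_1,\alpha_2,\phi)$, and $L_{Z_i}$ denotes the Lie derivative along $Z_i$, then (for $i=1,2$) $L_{Z_i}\phi=0$ if and only if $Z_i$ is a Killing vector field of $g$.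
   Context: All objects are smooth; $\Gamma(TM)$ denotes the space of vector fields on $M$. A contact pair of type $(h,k)$ on $M$ is a pair $(\alpha_1,\alpha_2)$ of $1$-forms such that $\alpha_1\wedge(d\alpha_1)^h\wedge\alpha_2\wedge(d\alpha_2)^k$ is a volume form, $(d\alpha_1)^{h+1}=0$ and $(d\alpha_2)^{k+1}=0$ (so $\dim M=2h+2k+2$). Its Reeb vector fields $Z_1,Z_2$ are the two commuting vector fields uniquely determined by $\alpha_i(Z_j)=\delta_{ij}$ and $i_{Z_j}d\alpha_i=0$ for $i,j=1,2$. Since they commute, they determine a locally free $\mathbb{R}^2$-action, called the Reeb action; its orbits are the leaves of the foliation tangent to $\mathrm{span}(Z_1,Z_2)$. A contact pair structure on $M$ is a triple $(\alpha_1,\alpha_2,\phi)$ where $(\alpha_1,\alpha_2)$ is a contact pair and $\phi$ is a tensor field of type $(1,1)$ with $\phi^2=-Id+\alpha_1\otimes Z_1+\alpha_2\otimes Z_2$ and $\phi(Z_1)=\phi(Z_2)=0$. A Riemannian metric $g$ on $M$ is called compatible with respect to $(\alpha_1,\alpha_2,\phi)$ if $g(\phi X,\phi Y)=g(X,Y)-\alpha_1(X)\alpha_1(Y)-\alpha_2(X)\alpha_2(Y)$ for all $X,Y\in\Gamma(TM)$. It is called associated if $g(X,\phi Y)=(d\alpha_1+d\alpha_2)(X,Y)$ and $g(X,Z_i)=\alpha_i(X)$ for $i=1,2$ and all $X,Y\in\Gamma(TM)$. *)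

(* Defs.v *)
From HB Require Import structures.
From mathcomp Require Import all_boot all_order all_algebra all_fingroup.
From mathcomp Require Import all_classical all_reals topology normedtype landau.
From mathcomp Require Import derive.

Set Implicit Arguments.
Unset Strict Implicit.
Unset Printing Implicit Defensive.

Import Order.TTheory GRing.Theory Num.Theory.
Import numFieldNormedType.Exports.

Local Open Scope classical_set_scope.
Local Open Scope ring_scope.

Section SmoothOn.
Context {R : realType}.

(* Meant for [A] open in a finite-dimensional space. *)
Fixpoint Ck (k : nat) {V W : normedModType R} (A : set V) (f : V -> W) : Prop :=
  if k is k'.+1
  then (forall x, A x -> differentiable f x) /\ (forall v, Ck k' A ('D_v f))
  else forall x, A x -> {for x, continuous f}.

Definition smooth_on {V W : normedModType R} (A : set V) (f : V -> W) : Prop :=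
  forall k, Ck k A f.

Lemma Ck_cont k (V W : normedModType R) (A : set V) (f : V -> W) :
  Ck k A f -> forall x, A x -> {for x, continuous f}.
Proof.
by case: k => [//|k] [df _] x Ax; apply: differentiable_continuous; exact: df.
Qed.

Lemma CkS k (V W : normedModType R) (A : set V) (f : V -> W) :
  Ck k.+1 A f -> Ck k A f.
Proof.
elim: k f => [|k IH] f; first exact: Ck_cont.
by move=> [df Df]; split=> // v; apply/IH/Df.
Qed.

Lemma near_eq_diff (V W : normedModType R) (f g : V -> W) x :
  (\near x, f x = g x) -> differentiable g x ->
  differentiable f x /\ 'd f x = 'd g x :> (V -> W).
Proof.
move=> fg /diff_locallyP[cg eg].
have fxg : f x = g x := nbhs_singleton fg.
have ef : f \o shift x = cst (f x) + 'd g x +o_ 0 id.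
  apply/eqaddoP => e e0.
  move/eqaddoP : eg => /(_ e e0) eg.
  have fg0 : \forall h \near 0, f (h + x) = g (h + x).
    have : \forall y \near x, f y = g y by [].
    by rewrite (near_shift 0 x)/= subr0.
  near=> h.
  have -> : (f \o shift x - (cst (f x) + 'd g x)) h =
            (g \o shift x - (cst (g x) + 'd g x)) h.
    rewrite /GRing.add /GRing.opp /= fxg; congr (_ - _).
    by near: h.
  by near: h.
have e := diff_unique cg ef.
split=> //; apply/diff_locallyP; rewrite e; split=> //.
Unshelve. all: by end_near. Qed.

Lemma near_open (V W : normedModType R) (A : set V) (f g : V -> W) x :
  open A -> A x -> (forall y, A y -> f y = g y) -> \near x, f x = g x.
Proof.
move=> oA Ax fg; have : \near x, A x by apply: open_nbhs_nbhs.
by apply: filterS => y; exact: fg.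
Qed.

Lemma Ck_local k (V W : normedModType R) (A : set V) (f : V -> W) :
  (forall x, A x -> exists B (g : V -> W), [/\ open B, B x,
     (forall y, B y -> f y = g y) & Ck k B g]) ->
  Ck k A f.
Proof.
elim: k f => [|k IH] f H.
  move=> x /H [B [g [oB Bx fg gk]]].
  have e := near_open oB Bx fg.
  rewrite /prop_for /continuous_at (fg _ Bx).
  apply: cvg_trans (gk _ Bx); apply: near_eq_cvg.
  by near=> y; apply/esym; near: y.
split.
  move=> x /H [B [g [oB Bx fg [dg _]]]].
  by have [] := near_eq_diff (near_open oB Bx fg) (dg _ Bx).
move=> v; apply: IH => x /H [B [g [oB Bx fg [dg Dg]]]].
exists B, ('D_v g); split=> //; last exact: Dg.
move=> y By.
have [df e] := near_eq_diff (near_open oB By fg) (dg _ By).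
by rewrite !deriveE ?e//; exact: dg.
Unshelve. all: by end_near. Qed.

Lemma Ck_eq k (V W : normedModType R) (A : set V) (f g : V -> W) :
  open A -> (forall x, A x -> f x = g x) -> Ck k A g -> Ck k A f.
Proof. by move=> oA fg gk; apply: Ck_local => x Ax; exists A, g. Qed.

Lemma Ck_cst k (V W : normedModType R) (A : set V) (c : W) :
  Ck k A (cst c : V -> W).
Proof.
elim: k c => [|k IH] c /=; first by move=> x _; exact: cvg_cst.
split=> // v; rewrite (_ : 'D_v _ = cst 0); first exact: IH.
by apply/funext => x; rewrite derive_cst.
Qed.

Lemma CkD k (V W : normedModType R) (A : set V) (f g : V -> W) :
  open A -> Ck k A f -> Ck k A g -> Ck k A (f + g).
Proof.
move=> oA; elim: k f g => [|k IH] f g /=.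
  by move=> cf cg x Ax; apply: continuousD; [exact: cf|exact: cg].
move=> [df Df] [dg Dg]; split=> [x Ax|v].
  by apply: differentiableD; [exact: df|exact: dg].
apply: (@Ck_eq _ _ _ _ _ ('D_v f + 'D_v g)) => //; last exact: IH.
by move=> x Ax; rewrite deriveD//; apply: diff_derivable;
  [exact: df|exact: dg].
Qed.

Lemma Ck_sum k (V W : normedModType R) (A : set V) n (f : 'I_n -> V -> W) :
  open A -> (forall i, Ck k A (f i)) -> Ck k A (\sum_i f i).
Proof.
move=> oA fk; elim/big_ind: _ => //; first exact: Ck_cst.
by move=> g h; exact: CkD.
Qed.

Lemma CkM k (V : normedModType R) (A : set V) (f g : V -> R) :
  open A -> Ck k A f -> Ck k A g -> Ck k A (f * g).
Proof.
move=> oA; elim: k f g => [|k IH] f g.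
  by move=> cf cg x Ax; exact: (continuousM (cf x Ax) (cg x Ax)).
move=> fk gk; have [df Df] := fk; have [dg Dg] := gk; split=> [x Ax|v].
  by apply: differentiableM; [exact: df|exact: dg].
apply: (@Ck_eq _ _ _ _ _ (f * 'D_v g + g * 'D_v f)) => //.
  by move=> x Ax; rewrite deriveM//; apply: diff_derivable;
    [exact: df|exact: dg].
by apply: CkD => //; apply: IH;
  [exact: CkS fk|exact: Dg|exact: CkS gk|exact: Df].
Qed.

Lemma Ck_coord k (V : normedModType R) n (A : set V) (g : V -> 'rV[R]_n) i :
  open A -> Ck k A g -> Ck k A (fun x => g x ord0 i).
Proof.
move=> oA.
pose c := fun M : 'rV[R]_n => M ord0 i.
have clin : linear c by move=> a u v; rewrite /c !mxE.
pose lm := GRing.isLinear.Build R 'rV[R]_n R *%R c clin.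
pose C : {linear 'rV[R]_n -> R} := HB.pack c lm.
have cC : continuous C by move=> M; exact: coord_continuous.
elim: k g => [|k IH] g /=.
  move=> cg x Ax; apply: (@continuous_comp _ _ _ g c); first exact: cg.
  exact: cC.
move=> [dg Dg]; split=> [x Ax|v].
  apply: (@differentiable_comp _ _ _ _ g C); first exact: dg.
  exact: linear_differentiable.
apply: (@Ck_eq _ _ _ _ _ (fun x => ('D_v g x) ord0 i)) => //; last exact: IH.
move=> x Ax.
have dgx := dg _ Ax.
have dC : differentiable C (g x) by exact: linear_differentiable.
rewrite (deriveE v (differentiable_comp dgx dC : differentiable (C \o g) x)).
by rewrite (diff_comp dgx dC)/= (diff_lin _ cC) deriveE.
Qed.

Lemma Ck_comp k (V : normedModType R) n (A : set V) (B : set 'rV[R]_n)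
    (g : V -> 'rV[R]_n) (f : 'rV[R]_n -> R) :
  open A -> (forall x, A x -> B (g x)) ->
  Ck k A g -> Ck k B f -> Ck k A (f \o g).
Proof.
move=> oA AB; elim: k f => [|k IH] f.
  move=> /= cg cf x Ax; apply: continuous_comp; first exact: cg.
  exact/cf/AB.
move=> gk fk; have [dg Dg] := gk; have [df Df] := fk; split=> [x Ax|v].
  by apply: differentiable_comp; [exact: dg|exact: df (AB _ Ax)].
apply: (@Ck_eq _ _ _ _ _
  (\sum_i (fun x => 'D_v g x ord0 i) * ('D_(delta_mx ord0 i) f \o g))) => //.
  move=> x Ax; have dgx := dg _ Ax; have dfx := df _ (AB _ Ax).
  rewrite deriveE; last exact: differentiable_comp.
  rewrite diff_comp//= -(deriveE v dgx) {1}(row_sum_delta ('D_v g x)).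
  rewrite linear_sum fct_sumE; apply: eq_bigr => i _.
  by rewrite linearZ /= -deriveE.
apply: Ck_sum => // i; apply: CkM => //; first exact: Ck_coord (Dg v).
by apply: IH; [exact: CkS gk|exact: Df].
Qed.

End SmoothOn.

Record chart (R : realType) (T : topologicalType) (n : nat) := Chart {
  chart_dom : set T;
  chart_map :> T -> 'rV[R]_n;
  chart_inv : 'rV[R]_n -> T;
  chart_dom_open : open chart_dom;
  chart_img_open : open (chart_map @` chart_dom);
  chart_invK : forall p, chart_dom p -> chart_inv (chart_map p) = p;
  chart_cont : forall p, chart_dom p -> {for p, continuous chart_map};
  chart_inv_cont : forall p, chart_dom p ->
    {for chart_map p, continuous chart_inv} }.

Record manifold (R : realType) := Manifold {
  mcarrier :> topologicalType;
  mdim : nat;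
  matlas : set (chart R mcarrier mdim);
  m_hausdorff : hausdorff_space mcarrier;
  m_second_countable : @second_countable mcarrier;
  matlas_cover : forall p : mcarrier, exists2 c, matlas c & chart_dom c p;
  matlas_compat : forall c d, matlas c -> matlas d ->
    smooth_on (c @` (chart_dom c `&` chart_dom d)) (d \o chart_inv c) }.

Arguments chart_img_open {R T n}.
Arguments matlas {R}.

Lemma chart_image_open (R : realType) (T : topologicalType) n (c : chart R T n)
  (U : set T) : open U -> open (c @` (chart_dom c `&` U)).
Proof.
move=> oU; rewrite openE => _ [p [cp Up] <-].
have nimg : nbhs (c p) (c @` chart_dom c).
  by apply: open_nbhs_nbhs; split; [exact: chart_img_open|exists p].
have ninv : nbhs (c p) (chart_inv c @^-1` U).
  apply: (chart_inv_cont cp); rewrite chart_invK//.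
  exact: open_nbhs_nbhs.
apply: filterS (filterI nimg ninv) => y [[q cq <-]] /=.
by rewrite chart_invK// => Uq; exists q.
Qed.

Definition is_smooth (R : realType) (M : manifold R) (f : M -> R) : Prop :=
  forall c, matlas M c -> smooth_on (c @` chart_dom c) (f \o chart_inv c).

Definition smooth_pred (R : realType) (M : manifold R) : {pred (M -> R)} :=
  [pred f | `[< is_smooth f >]].
Arguments smooth_pred {R} M.

Record sfun (R : realType) (M : manifold R) :=
  SFun { sfun_val :> M -> R; _ : sfun_val \in smooth_pred M }.
Arguments SFun {R M}.

Section SmoothFunctions.
Context {R : realType} (M : manifold R).

HB.instance Definition _ := [isSub for @sfun_val R M].
HB.instance Definition _ := [Choice of sfun M by <:].

Lemma smooth_subring : subring_closed (smooth_pred M).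
Proof.
split=> [|f g /asboolP fs /asboolP gs|f g /asboolP fs /asboolP gs];
  apply/asboolP => c cM k; have oc := chart_img_open c.
- exact: (Ck_cst _ _ (1 : R)).
- have -> : (f - g) \o chart_inv c =
    (f \o chart_inv c) + cst (-1) * (g \o chart_inv c).
    by apply/funext => x; rewrite !fctE /= mulN1r.
  by apply: CkD => //; [exact: fs|apply: CkM => //; [exact: Ck_cst|exact: gs]].
- by apply: CkM => //; [exact: fs|exact: gs].
Qed.

Lemma smooth_submod : submod_closed (smooth_pred M).
Proof.
split=> [|a f g /asboolP fs /asboolP gs]; apply/asboolP => c cM k;
  have oc := chart_img_open c.
- exact: (Ck_cst _ _ (0 : R)).
- have -> : (a *: f + g) \o chart_inv c =
    cst a * (f \o chart_inv c) + (g \o chart_inv c) by [].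
  by apply: CkD => //; [apply: CkM => //; [exact: Ck_cst|exact: fs]|exact: gs].
Qed.

HB.instance Definition _ := GRing.SubChoice_isSubComPzRing.Build
  (M -> R) (smooth_pred M) (sfun M) smooth_subring.
HB.instance Definition _ :=
  GRing.isSubmodClosed.Build R (M -> R) (smooth_pred M) smooth_submod.
HB.instance Definition _ := [SubZmodule_isSubLmodule of sfun M by <:].

End SmoothFunctions.

Record smap (R : realType) (N M : manifold R) := SMap {
  smap_fun :> N -> M;
  smap_cont : continuous smap_fun;
  smap_smooth : forall c d, matlas N c -> matlas M d ->
    smooth_on (c @` (chart_dom c `&` smap_fun @^-1` chart_dom d))
              (d \o smap_fun \o chart_inv c) }.

Section Pullback.
Context {R : realType} (N M : manifold R).

Lemma pullback_smooth (F : smap N M) (f : sfun M) : f \o F \in smooth_pred N.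
Proof.
case: f => f /= /asboolP fs; apply/asboolP => c cN k.
apply: Ck_local => _ [q cq <-].
have [d dM dFq] := matlas_cover (F q).
pose A := c @` (chart_dom c `&` F @^-1` chart_dom d).
have oA : open A.
  apply/chart_image_open/open_comp; last exact: chart_dom_open.
  by move=> x _; exact: smap_cont.
exists A, ((f \o chart_inv d) \o (d \o F \o chart_inv c)); split=> //.
- by exists q.
- by move=> _ [r [cr dr] <-] /=; rewrite !chart_invK.
apply: (@Ck_comp _ _ _ _ _ (d @` chart_dom d)) => //.
- by move=> _ [r [cr dr] <-]; exists (F r); rewrite //= chart_invK.
- exact: smap_smooth.
- exact: fs.
Qed.

Definition pullback (F : smap N M) (f : sfun M) : sfun N :=
  SFun (f \o F) (pullback_smooth F f).

End Pullback.

(* Vector fields are the derivations of the algebra of smooth functions; [X f]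
   is the derivative of [f] along [X], and two vector fields agree at [p] when
   they give the same value [X f p] for every [f]. *)
Definition is_derivation (R : realType) (M : manifold R)
    (D : sfun M -> sfun M) : Prop :=
  (forall (a : R) (f g : sfun M), D (a *: f + g) = a *: D f + D g) /\
  (forall f g : sfun M, D (f * g) = D f * g + f * D g).

Definition derivation_pred (R : realType) (M : manifold R) :
    {pred (sfun M -> (sfun M)^o)} :=
  [pred D | `[< is_derivation (D : sfun M -> sfun M) >]].
Arguments derivation_pred {R} M.

Record vfield (R : realType) (M : manifold R) :=
  VField { vfield_val :> sfun M -> (sfun M)^o;
           _ : vfield_val \in derivation_pred M }.
Arguments VField {R M}.

Section VectorFields.
Context {R : realType} (M : manifold R).

HB.instance Definition _ := [isSub for @vfield_val R M].
HB.instance Definition _ := [Choice of vfield M by <:].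

Lemma sfun_scale (a : R) (f g : sfun M) : f * (a *: g) = a *: (f * g).
Proof.
by apply/val_inj/funext => p; rewrite /= /GRing.mul /= /GRing.scale /= mulrCA.
Qed.

Lemma derivation_submod : submod_closed (derivation_pred M).
Proof.
split=> [|h D E /asboolP[Dl DL] /asboolP[El EL]]; apply/asboolP.
  split=> [a f g|f g]; first by rewrite /= scaler0 addr0.
  by rewrite /= mul0r mulr0 addr0.
pose DE f : sfun M := h * (D f : sfun M) + E f.
have DEl (a : R) f g : DE (a *: f + g) = a *: DE f + DE g.
  by rewrite /DE Dl El mulrDr sfun_scale scalerDr addrACA.
have DEL f g : DE (f * g) = DE f * g + f * DE g.
  by rewrite /DE DL EL !mulrDr mulrDl addrACA !mulrA [h * f]mulrC.
by split; [exact: DEl|exact: DEL].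
Qed.

HB.instance Definition _ := GRing.SubChoice_isSubLmodule.Build
  (sfun M) (sfun M -> (sfun M)^o) (derivation_pred M) (vfield M)
  (GRing.submod_closed_semi derivation_submod).

Lemma vfieldP (X : vfield M) : is_derivation (X : sfun M -> sfun M).
Proof. by case: X => D DP; exact/asboolP. Qed.

Lemma derivationD (D : sfun M -> sfun M) f g :
  is_derivation D -> D (f + g) = D f + D g.
Proof. by move=> [Dl _]; rewrite -[f in LHS]scale1r Dl scale1r. Qed.

Lemma derivationZ (D : sfun M -> sfun M) (a : R) f :
  is_derivation D -> D (a *: f) = a *: D f.
Proof.
move=> [Dl _]; have D0 : D 0 = 0.
  have := Dl 1 0 0; rewrite scaler0 addr0 scale1r.
  by move=> /esym/(canRL (addrK _)); rewrite subrr.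
by rewrite -[a *: f]addr0 Dl D0 addr0.
Qed.

Lemma bracket_proof (X Y : vfield M) :
  (fun f => X (Y f) - Y (X f)) \in derivation_pred M.
Proof.
apply/asboolP; have Xd := vfieldP X; have Yd := vfieldP Y.
have [_ XL] := Xd; have [_ YL] := Yd.
pose B f : sfun M := X (Y f) - Y (X f).
have Bl (a : R) (f g : sfun M) : B (a *: f + g) = a *: B f + B g.
  rewrite /B !(derivationD _ _ Xd, derivationZ _ _ Xd, derivationD _ _ Yd,
    derivationZ _ _ Yd) scalerBr opprD addrACA.
  by [].
have BL (f g : sfun M) : B (f * g) = B f * g + f * B g.
  rewrite /B XL YL !(derivationD _ _ Xd, derivationD _ _ Yd) XL YL XL YL.
  rewrite mulrBl mulrBr.
  have E (a p q b a' b' : sfun M) :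
      a + p + (q + b) - (a' + q + (p + b')) = a - a' + (b - b').
    rewrite [q + b]addrC [p + b']addrC addrACA [X in _ - X]addrACA [q + p]addrC.
    by rewrite opprD [LHS]addrACA subrr addr0 opprD [LHS]addrACA.
  exact: E.
by split; [exact: Bl|exact: BL].
Qed.

Definition bracket (X Y : vfield M) : vfield M := VField _ (bracket_proof X Y).

End VectorFields.

(* Tensor fields are multilinear over the ring of smooth functions. *)
Notation oneform M := {linear vfield M -> (sfun M)^o}.
Notation endofield M := {linear vfield M -> vfield M}.

Section Forms.
Context {R : realType} {M : manifold R}.

(* A [p]-form is given by its values on [p]-tuples of vector fields; only the
   forms obtained from 1-forms by [extd] and [wedge] are used, and these are
   alternating and multilinear. *)
Definition form (p : nat) := ('I_p -> vfield M) -> sfun M.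

Definition form1 (alpha : oneform M) : form 1 := fun X => alpha (X ord0).

(* No factor 1/2. *)
Definition extd (alpha : oneform M) (X Y : vfield M) : sfun M :=
  X (alpha Y : sfun M) - Y (alpha X : sfun M) - alpha (bracket X Y).

Definition extd2 (alpha : oneform M) : form 2 :=
  fun X => extd alpha (X ord0) (X ord_max).

Definition wedge p q (w : form p) (e : form q) : form (p + q)%N := fun X =>
  ((p`! * q`!)%N%:R^-1 : R) *:
  \sum_(s : 'S_(p + q)%N) (-1) ^+ s * w (fun i => X (s (lshift q i)))
                                  * e (fun j => X (s (rshift p j))).

Fixpoint wedge_pow (w : form 2) (h : nat) : form (h * 2)%N :=
  if h is h'.+1 then wedge w (@wedge_pow w h') else fun=> 1.
Arguments wedge_pow w h : clear implicits.

Definition is_volume_form p (w : form p) : Prop :=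
  p = mdim M /\ forall m : M, exists X, w X m != 0.

(* [alpha 0] and [alpha 1] are the two forms of the pair. *)
Definition is_contact_pair (h k : nat) (alpha : 'I_2 -> oneform M) : Prop :=
  [/\ is_volume_form
        (wedge (form1 (alpha 0)) (wedge (wedge_pow (extd2 (alpha 0)) h)
          (wedge (form1 (alpha 1)) (wedge_pow (extd2 (alpha 1)) k)))),
      wedge_pow (extd2 (alpha 0)) h.+1 = (fun=> 0)
    & wedge_pow (extd2 (alpha 1)) k.+1 = (fun=> 0)].

Definition are_reeb_fields (alpha : 'I_2 -> oneform M) (Z : 'I_2 -> vfield M) :
    Prop :=
  [/\ bracket (Z 0) (Z 1) = 0,
      forall i j, alpha i (Z j) = (i == j)%:R
    & forall i j (X : vfield M), extd (alpha i) (Z j) X = 0].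

Definition is_contact_pair_structure (alpha : 'I_2 -> oneform M)
    (Z : 'I_2 -> vfield M) (phi : endofield M) : Prop :=
  (forall X, phi (phi X) =
     - X + (alpha 0 X : sfun M) *: Z 0 + (alpha 1 X : sfun M) *: Z 1) /\
  (forall i, phi (Z i) = 0).

End Forms.
Arguments wedge_pow {R M} w h.

Record metric (R : realType) (M : manifold R) := Metric {
  metric_val :> vfield M -> vfield M -> sfun M;
  metric_linear : forall (f : sfun M) X Y W,
    metric_val (f *: X + Y) W = f * metric_val X W + metric_val Y W;
  metric_sym : forall X Y, metric_val X Y = metric_val Y X;
  metric_ge0 : forall X (p : M), 0 <= metric_val X X p;
  metric_definite : forall X (p : M),
    metric_val X X p = 0 <-> (forall f, X f p = 0) }.

Section Riemannian.
Context {R : realType} {M : manifold R}.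
Implicit Types (g : metric M) (nabla : vfield M -> vfield M -> vfield M).

Definition is_levi_civita g nabla : Prop :=
  [/\ forall (f : sfun M) X Y W,
        nabla (f *: X + Y) W = f *: nabla X W + nabla Y W,
      forall X Y W, nabla X (Y + W) = nabla X Y + nabla X W,
      forall (f : sfun M) (X Y : vfield M),
        nabla X (f *: Y) = (X f : sfun M) *: Y + f *: nabla X Y,
      forall X Y, nabla X Y - nabla Y X = bracket X Y
    & forall X Y W : vfield M,
        X (g Y W) = g (nabla X Y) W + g Y (nabla X W)].

Definition is_compatible g (alpha : 'I_2 -> oneform M) (phi : endofield M) :=
  forall X Y, g (phi X) (phi Y) =
    g X Y - (alpha 0 X : sfun M) * alpha 0 Y - (alpha 1 X : sfun M) * alpha 1 Y.

Definition is_associated g (alpha : 'I_2 -> oneform M) (Z : 'I_2 -> vfield M)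
    (phi : endofield M) : Prop :=
  (forall X Y, g X (phi Y) = extd (alpha 0) X Y + extd (alpha 1) X Y) /\
  (forall i X, g X (Z i) = alpha i X).

Definition lie_endo (Z : vfield M) (phi : endofield M) (X : vfield M) :
    vfield M :=
  bracket Z (phi X) - phi (bracket Z X).

Definition lie_metric (Z : vfield M) g (X Y : vfield M) : sfun M :=
  Z (g X Y) - g (bracket Z X) Y - g X (bracket Z Y).

Definition is_killing g (Z : vfield M) : Prop :=
  forall X Y, lie_metric Z g X Y = 0.

Definition has_velocity (c : R -> M) (t : R) (X : vfield M) : Prop :=
  forall f : sfun M, is_derive t (1 : R) (f \o c) (X f (c t)).

Definition is_integral_curve (X : vfield M) (J : set R) (c : R -> M) : Prop :=
  forall t, J t -> has_velocity c t X.

(* For [J] open. The acceleration is computed with an extension [Y] of the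
   velocity to a vector field on [M]; such a local extension exists around every
   time at which the velocity is nonzero, and [Y = 0] serves for constant
   curves. *)
Definition is_geodesic nabla (J : set R) (c : R -> M) : Prop :=
  forall t0, J t0 -> exists Y : vfield M,
    \forall t \near t0, has_velocity c t Y /\ forall f, nabla Y Y f (c t) = 0.

End Riemannian.

(* Derivations at [p] of the algebra of germs of smooth functions. *)
Record tangent (R : realType) (M : manifold R) (p : M) := Tangent {
  tangent_val :> sfun M -> R;
  tangent_linear : forall (a : R) f g,
    tangent_val (a *: f + g) = a * tangent_val f + tangent_val g;
  tangent_leibniz : forall f g,
    tangent_val (f * g) = tangent_val f * g p + f p * tangent_val g;
  tangent_germ : forall f g : sfun M,
    (\forall q \near p, f q = g q) -> tangent_val f = tangent_val g }.

Section Submanifolds.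
Context {R : realType} {N M : manifold R}.
Implicit Types (iota : smap N M) (X : vfield M).

Definition is_immersion iota : Prop :=
  forall q (u : tangent q), (forall f, u (pullback iota f) = 0) ->
    forall f, u f = 0.

Definition tangent_along iota X (q : N) : Prop :=
  exists u : tangent q, forall f, X f (iota q) = u (pullback iota f).

(* The second fundamental form, computed with extensions of tangent fields of
   [N] to [M], vanishes. The extensions are only tangent to [N] along some open
   [U], since [iota] need not be an embedding. *)
Definition is_totally_geodesic (nabla : vfield M -> vfield M -> vfield M)
    iota : Prop :=
  forall (U : set N) X Y, open U ->
    (forall q, U q -> tangent_along iota X q) ->
    (forall q, U q -> tangent_along iota Y q) ->
    forall q, U q -> tangent_along iota (nabla X Y) q.

Definition is_integral_surface (Z : 'I_2 -> vfield M) iota : Prop :=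
  [/\ mdim N = 2%N, injective iota, is_immersion iota
    & forall (q : N) (w : sfun M -> R),
        (exists u : tangent q, forall f, w f = u (pullback iota f)) <->
        (exists a b : R, forall f,
           w f = a * Z 0 f (iota q) + b * Z 1 f (iota q))].

End Submanifolds.

(* The orbits of the (local) action of the plane generated by the commuting
   fields [Z 0], [Z 1] are the leaves, i.e. the maximal connected integral
   surfaces, of the foliation that these fields span. *)
Definition is_orbit (R : realType) (M : manifold R) (Z : 'I_2 -> vfield M)
    (N : manifold R) (iota : smap N M) : Prop :=
  [/\ is_integral_surface Z iota, connected [set: N], [set: N] !=set0
    & forall (N' : manifold R) (iota' : smap N' M),
        is_integral_surface Z iota' -> connected [set: N'] ->
        range iota `&` range iota' !=set0 -> range iota' `<=` range iota].

(* Main.v *)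
Require Import Defs.
From mathcomp Require Import all_boot all_order all_algebra.
From mathcomp Require Import all_classical all_reals topology normedtype.
From mathcomp Require Import ring lra.

Set Implicit Arguments.
Unset Strict Implicit.
Unset Printing Implicit Defensive.

Import Order.TTheory GRing.Theory Num.Theory.
Import numFieldNormedType.Exports.

Local Open Scope classical_set_scope.
Local Open Scope ring_scope.

(* Compatibility with [phi Z_i = 0] gives [g(Z_i, .) = alpha_i]. Since
   [i_{Z_j} d alpha_i = 0], the Reeb fields preserve both forms, and Koszul's
   identities reduce [g(nabla_{Z_i} Z_j, X)] to [- X(g(Z_i, Z_j)) / 2 = 0]. On an
   integral surface a tangent field is [Y = sum_j alpha_j(Y) Z_j] up to a field
   vanishing along the surface, so
   [nabla_X Y = sum_j X(alpha_j(Y)) Z_j] there, which is tangent. For an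
   associated metric, [L_{Z_i} (d alpha_1 + d alpha_2) = 0] reads
   [(L_{Z_i} g)(X, phi Y) = - g(X, (L_{Z_i} phi) Y)], and [L_{Z_i} g] always
   vanishes on the Reeb fields, which complement the image of [phi]. *)

(** * Derivations, brackets and exterior derivatives *)

Section VectorFieldCalculus.
Context {R : realType} {M : manifold R}.
Implicit Types (f : sfun M) (X Y V W : vfield M) (alpha : oneform M).

Lemma sfunP (f f' : sfun M) : (forall p, f p = f' p) -> f = f'.
Proof. by move=> ff'; apply/val_inj/funext. Qed.

Lemma sfunD (f f' : sfun M) p : (f + f') p = f p + f' p. Proof. by []. Qed.
Lemma sfunN f p : (- f) p = - f p. Proof. by []. Qed.
Lemma sfunM (f f' : sfun M) p : (f * f') p = f p * f' p. Proof. by []. Qed.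
Lemma sfunZ (a : R) f p : (a *: f) p = a * f p. Proof. by []. Qed.
Lemma sfun0 p : (0 : sfun M) p = 0. Proof. by []. Qed.
Lemma sfun1 p : (1 : sfun M) p = 1. Proof. by []. Qed.
Definition sfunE := (sfunD, sfunN, sfunM, sfunZ, sfun0, sfun1).

Lemma vfieldP_ext X Y : (forall f, X f = Y f :> sfun M) -> X = Y.
Proof. by move=> XY; apply/val_inj/funext. Qed.

Lemma vfD X Y f : (X + Y) f = X f + Y f :> sfun M. Proof. by []. Qed.
Lemma vfN X f : (- X) f = - X f :> sfun M. Proof. by []. Qed.
Lemma vfZ (h : sfun M) X f : (h *: X) f = h * X f :> sfun M. Proof. by []. Qed.
Lemma vf0 f : (0 : vfield M) f = 0 :> sfun M. Proof. by []. Qed.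
Definition vfE := (vfD, vfN, vfZ, vf0).

Lemma bracketE X Y f : bracket X Y f = X (Y f) - Y (X f) :> sfun M.
Proof. by []. Qed.

Lemma derB X f f' : X (f - f') = X f - X f' :> sfun M.
Proof.
have Xd := vfieldP X.
by rewrite (derivationD _ _ Xd) -scaleN1r (derivationZ _ _ Xd) scaleN1r.
Qed.

Lemma der_nat X (n : nat) : X n%:R = 0 :> sfun M.
Proof.
have [_ XL] := vfieldP X.
have X1 : X 1 = 0 :> sfun M.
  apply/sfunP => p; have := congr1 (fun f : sfun M => f p) (XL 1 1).
  by rewrite mulr1 mul1r !sfunE => ?; lra.
elim: n => [|n IH]; first by have := derB X 0 0; rewrite !subrr.
by rewrite -[n.+1]addn1 natrD (derivationD _ _ (vfieldP X)) X1 addr0.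
Qed.

Lemma jacobi X Y W :
  bracket W (bracket X Y) = bracket (bracket W X) Y + bracket X (bracket W Y).
Proof.
apply/vfieldP_ext => f; apply/sfunP => p.
by rewrite vfD !bracketE !derB !sfunE; ring.
Qed.

Lemma bracketC X Y : bracket X Y = - bracket Y X.
Proof. by apply/vfieldP_ext => f; rewrite vfN !bracketE opprB. Qed.

Lemma bracketxx X : bracket X X = 0.
Proof. by apply/vfieldP_ext => f; rewrite bracketE subrr. Qed.

Lemma oneformD alpha X Y : alpha (X + Y) = alpha X + alpha Y :> sfun M.
Proof. exact: linearD. Qed.

(** The hypothesis says [L_Z alpha = 0]. The Lie derivative commutes with [d], so
    [L_Z (d alpha) = 0]; concretely this is the Jacobi identity. *)
Lemma lie_extd alpha (Z : vfield M) X Y :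
  (forall W, Z (alpha W) = alpha (bracket Z W) :> sfun M) ->
  Z (extd alpha X Y) =
  extd alpha (bracket Z X) Y + extd alpha X (bracket Z Y) :> sfun M.
Proof.
move=> Zalpha; rewrite /extd !derB Zalpha jacobi oneformD !bracketE !Zalpha.
by apply/sfunP => p; rewrite !sfunE; ring.
Qed.

End VectorFieldCalculus.

(** * Pointwise behaviour of a metric *)

Section Metric.
Context {R : realType} {M : manifold R} (g : metric M).
Implicit Types (f : sfun M) (X Y V W : vfield M).

Lemma metricDl X Y W : g (X + Y) W = g X W + g Y W.
Proof. by rewrite -[X]scale1r metric_linear mul1r scale1r. Qed.

Lemma metric0l W : g 0 W = 0.
Proof. by apply: (addIr (g 0 W)); rewrite -metricDl !add0r. Qed.

Lemma metricZl f X W : g (f *: X) W = f * g X W.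
Proof. by rewrite -[f *: X]addr0 metric_linear metric0l addr0. Qed.

Lemma metricNl X W : g (- X) W = - g X W.
Proof. by rewrite -scaleN1r metricZl mulN1r. Qed.

Lemma metricDr X Y W : g W (X + Y) = g W X + g W Y.
Proof. by rewrite !(Defs.metric_sym g W) metricDl. Qed.

Lemma metric0r W : g W 0 = 0. Proof. by rewrite Defs.metric_sym metric0l. Qed.

Lemma metricZr f X W : g W (f *: X) = f * g W X.
Proof. by rewrite !(Defs.metric_sym g W) metricZl. Qed.

Lemma metricNr X W : g W (- X) = - g W X.
Proof. by rewrite !(Defs.metric_sym g W) metricNl. Qed.

Definition metricE := (metricDl, metricNl, metricZl, metric0l,
  metricDr, metricNr, metricZr, metric0r).

(** Links the values of [g] at [p] with those of the fields at [p]. If [V] vanishes at [p] then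
    [g V V p = 0], so [g(tV + W, tV + W)] at [p] is affine in [t]; being nonnegative, it has slope
    zero. *)
Lemma metric_orth_at V (p : M) :
  (forall W, g V W p = 0) <-> (forall f, V f p = 0).
Proof.
split=> [V0|/(metric_definite g) gV W].
  by apply/(metric_definite g); exact: V0.
apply/eqP/negPn/negP => gVW.
(* Chosen so that [2 t g(V, W) + g(W, W) = -1] at [p]. *)
pose t := - (g W W p + 1) / (2 * g V W p).
have := metric_ge0 g ((t *: (1 : sfun M) : sfun M) *: V + W) p.
rewrite !metricE (Defs.metric_sym g W V) !sfunE gV.
have : t * g V W p = - (g W W p + 1) / 2 by rewrite /t; field.
by rewrite !mulr1 mulr0 add0r => ->; lra.
Qed.

Lemma metric_at X Y W (p : M) :
  (forall f, X f p = Y f p) -> g X W p = g Y W p.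
Proof.
move=> XY; apply/eqP; rewrite -subr_eq0 -sfunN -sfunD -metricNl -metricDl.
apply/eqP; move: W; apply/metric_orth_at => f.
by rewrite !vfE !sfunE XY subrr.
Qed.

Lemma metric_nondegenerate V : (forall W, g V W = 0) -> V = 0.
Proof.
move=> V0; apply/vfieldP_ext => f; apply/sfunP => p; move: f.
by apply/metric_orth_at => W; rewrite V0.
Qed.

End Metric.

Lemma ord2P (i : 'I_2) : i = 0 \/ i = 1.
Proof. by case: i => [[|[|//]] ?]; [left|right]; exact/val_inj. Qed.

(** * Reeb fields, compatible and associated metrics *)

Section CompatibleMetric.
Context {R : realType} {M : manifold R}.
Context (alpha : 'I_2 -> oneform M) (Z : 'I_2 -> vfield M) (phi : endofield M).
Context (g : metric M).
Context (reeb_Z : are_reeb_fields alpha Z).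
Implicit Types (f : sfun M) (X Y V W : vfield M).

Lemma reeb_bracket i j : bracket (Z i) (Z j) = 0.
Proof.
have [Z01 _ _] := reeb_Z.
by case: (ord2P i) (ord2P j) => -> [] ->; rewrite ?bracketxx// bracketC Z01 oppr0.
Qed.

(** This is [L_{Z_j} alpha_i = 0]: as [alpha_i(Z_j)] is constant, the formula for
    [d alpha_i (Z_j, X) = 0] loses its middle term. *)
Lemma lie_reeb i j X : Z j (alpha i X) = alpha i (bracket (Z j) X) :> sfun M.
Proof.
have [_ aZ /(_ i j X)] := reeb_Z; rewrite /extd aZ der_nat subr0.
exact: subr0_eq.
Qed.

Context (structure_phi : is_contact_pair_structure alpha Z phi).

Lemma compatible_reeb i X : is_compatible g alpha phi -> g (Z i) X = alpha i X.
Proof.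
have [[_ aZ _] [_ phiZ]] := (reeb_Z, structure_phi) => /(_ X (Z i)).
rewrite phiZ metric0r !aZ Defs.metric_sym => /esym.
by case: (ord2P i) => -> /=; rewrite ?mulr1 ?mulr0 ?subr0 => /subr0_eq.
Qed.

Lemma killing_iff_lie_endo_eq0 i : is_associated g alpha Z phi ->
  (forall X, lie_endo (Z i) phi X = 0) <-> is_killing g (Z i).
Proof.
move=> [gphi gZ].
have lieE X Y : lie_metric (Z i) g X (phi Y) = - g X (lie_endo (Z i) phi Y).
  rewrite /lie_metric /lie_endo !metricE !gphi.
  rewrite (derivationD _ _ (vfieldP (Z i))).
  rewrite !lie_extd; try by move=> W; exact: lie_reeb.
  by apply/sfunP => p; rewrite !sfunE; ring.
(* As [g(., Z_j) = alpha_j] and the Reeb fields commute, this is [L_{Z_i} alpha_j = 0]. *)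
have lieZ j X : lie_metric (Z i) g X (Z j) = 0.
  rewrite /lie_metric !gZ reeb_bracket metric0r lie_reeb subr0; exact: subrr.
have lieD X Y W : lie_metric (Z i) g X (Y + W) =
    lie_metric (Z i) g X Y + lie_metric (Z i) g X W.
  rewrite /lie_metric.
  have -> : bracket (Z i) (Y + W) = bracket (Z i) Y + bracket (Z i) W.
    apply/vfieldP_ext => f.
    rewrite vfD !bracketE !vfD (derivationD _ _ (vfieldP (Z i))).
    by apply/sfunP => p; rewrite !sfunE; ring.
  rewrite !metricE (derivationD _ _ (vfieldP (Z i))).
  by apply/sfunP => p; rewrite !sfunE; ring.
(* The two terms in [Z_i f] cancel, so [L_{Z_i} g] is tensorial and can be tested on a decomposition
   with function coefficients. *)
have lieS f X Y : lie_metric (Z i) g X (f *: Y) = f * lie_metric (Z i) g X Y.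
  rewrite /lie_metric; have [_ ZL] := vfieldP (Z i).
  have -> : bracket (Z i) (f *: Y) = (Z i f : sfun M) *: Y + f *: bracket (Z i) Y.
    apply/vfieldP_ext => f'; rewrite vfD !vfZ !bracketE vfZ ZL.
    by apply/sfunP => p; rewrite !sfunE; ring.
  rewrite !metricE ZL.
  by apply/sfunP => p; rewrite !sfunE; ring.
split=> [L0 X W|K Y].
  have [phi2 _] := structure_phi.
  (* The formula for [phi^2] splits [W] into an image of [phi], handled by [lieE], and a Reeb part,
     handled by [lieZ]. *)
  have -> : W = -1 *: phi (phi W) +
      ((alpha 0 W : sfun M) *: Z 0 + (alpha 1 W : sfun M) *: Z 1).
    by rewrite phi2 scaleN1r -addrA opprD opprK subrK.
  by rewrite !(lieD, lieS) !lieZ lieE L0 metric0r oppr0 !mulr0 !addr0.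
apply: (@metric_nondegenerate _ _ g) => X.
by rewrite Defs.metric_sym; apply/oppr_inj; rewrite -lieE K oppr0.
Qed.

(** * Covariant derivatives of the Reeb fields *)

Section LeviCivita.
Context (nabla : vfield M -> vfield M -> vfield M).
Context (levi_civita_nabla : is_levi_civita g nabla).

Lemma nabla_reeb i j : (forall k X, g (Z k) X = alpha k X) ->
  nabla (Z i) (Z j) = 0.
Proof.
have [_ aZ _] := reeb_Z; have [_ _ _ torsion compat] := levi_civita_nabla.
move=> gZ; apply: (@metric_nondegenerate _ _ g) => X; apply/sfunP => p.
(* Differentiate [g(Z_l, X)] along [Z_k]: invariance of [alpha_l] gives [g(Z_l, [Z_k, X])], which
   cancels the torsion term. *)
have half k l : g (nabla (Z k) (Z l)) X = - g (Z l) (nabla X (Z k)).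
  have := compat (Z k) (Z l) X; rewrite gZ lie_reeb -gZ.
  have := torsion (Z k) X => /(canRL (subrK _)) ->; rewrite metricDr => E.
  apply/sfunP => q; have := congr1 (fun f : sfun M => f q) E.
  by rewrite !sfunE => ?; lra.
have sym : nabla (Z i) (Z j) = nabla (Z j) (Z i).
  by apply: subr0_eq; rewrite torsion reeb_bracket.
(* [g(Z_i, Z_j)] is constant, so [E] makes the right-hand sides of [half i j] and [half j i] sum to
   zero; by [sym] their left-hand sides are equal. *)
have := compat X (Z i) (Z j); rewrite gZ aZ der_nat => /esym E.
have := congr1 (fun f : sfun M => f p) E; rewrite !sfunE => {}E.
have := congr1 (fun f : sfun M => f p) (half i j).
have := congr1 (fun f : sfun M => f p) (half j i).
rewrite -sym !sfunE; rewrite (Defs.metric_sym g _ (Z j)) in E.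
by move=> *; lra.
Qed.

End LeviCivita.

End CompatibleMetric.

(** * Fields vanishing along an immersed manifold *)

Section AlongImmersion.
Context {R : realType} {N M : manifold R} (iota : smap N M) (U : set N).
Context (g : metric M) (nabla : vfield M -> vfield M -> vfield M).
Context (open_U : open U) (levi_civita_nabla : is_levi_civita g nabla).
Implicit Types (f : sfun M) (X V W : vfield M) (q : N).

Definition vanishes_along V := forall r, U r -> forall f, V f (iota r) = 0.

(** A vector tangent to [N] acts on [f] through its pullback, whose germ at [q] is zero because [U]
    is open. *)
Lemma tangent_along_eq0 X q f : tangent_along iota X q -> U q ->
  (forall r, U r -> f (iota r) = 0) -> X f (iota q) = 0.
Proof.
move=> [u uX] Uq f0; rewrite uX.
have -> : u (pullback iota f) = u 0.
  apply: tangent_germ; have : \forall r \near q, U r by exact: open_nbhs_nbhs.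
  by apply: filterS => r /f0.
have := tangent_linear u 1 0 0.
by rewrite scaler0 addr0 mul1r => u0; apply: (addIr (u 0)); rewrite -u0 add0r.
Qed.

(** In [X(g(V, W)) = g(nabla_X V, W) + g(V, nabla_X W)] the function [g(V, W)] is zero along [U], so
    only the first term on the right could survive. *)
Lemma nabla_vanishing X V q : tangent_along iota X q -> U q ->
  vanishes_along V -> forall f, nabla X V f (iota q) = 0.
Proof.
move=> tX Uq V0; apply/(metric_orth_at g) => W.
have gV0 W' r : U r -> g V W' (iota r) = 0.
  by move=> Ur; move: W'; apply/metric_orth_at/V0.
have [_ _ _ _ compat] := levi_civita_nabla.
have := congr1 (fun f : sfun M => f (iota q)) (compat X V W).
rewrite !sfunE (tangent_along_eq0 tX Uq (gV0 W)) gV0// addr0.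
by move=> <-.
Qed.

(* [nabla_V X] is tensorial in [V], but pointwise tensoriality would need bump
   functions or local frames. Instead use [nabla_V X = nabla_X V + [V, X]], whose
   right-hand side differentiates the components of [V] only along [N]. *)
Lemma nabla_vanishing_direction X V q : tangent_along iota X q -> U q ->
  vanishes_along V -> forall f, nabla V X f (iota q) = 0.
Proof.
move=> tX Uq V0 f; have [_ _ _ torsion _] := levi_civita_nabla.
have := torsion V X => /(canRL (subrK _)) ->.
rewrite vfD bracketE !sfunE nabla_vanishing// V0// addr0 add0r.
rewrite (tangent_along_eq0 tX Uq) ?oppr0// => r Ur; exact: V0.
Qed.

End AlongImmersion.

(** * Integral surfaces of the Reeb fields *)

Section IntegralSurface.
Context {R : realType} {N M : manifold R} (iota : smap N M).
Context (alpha : 'I_2 -> oneform M) (Z : 'I_2 -> vfield M).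
Context (g : metric M) (nabla : vfield M -> vfield M -> vfield M).
Context (gZ : forall i X, g (Z i) X = alpha i X).
Context (alphaZ : forall i j, alpha i (Z j) = (i == j)%:R).
Context (surface_iota : is_integral_surface Z iota).
Implicit Types (f : sfun M) (X Y V W : vfield M) (q : N).

(** The [g]-orthogonal projection onto the span of the Reeb fields. *)
Definition reeb_part X : vfield M :=
  (alpha 0 X : sfun M) *: Z 0 + (alpha 1 X : sfun M) *: Z 1.

Lemma tangent_reeb i q : tangent_along iota (Z i) q.
Proof.
have [_ _ _ span] := surface_iota; apply/(span q (fun f => Z i f (iota q))).
case: (ord2P i) => ->; [exists 1, 0|exists 0, 1] => f; lra.
Qed.

Lemma tangent_reeb_part X q : tangent_along iota X q ->
  forall f, X f (iota q) = reeb_part X f (iota q).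
Proof.
have [_ _ _ span] := surface_iota.
move=> /(span q (fun f => X f (iota q))) [a [b Xab]].
(* Extends the vector at [iota q] with constant coefficients, so that [alpha_i(Y)] can be
   computed. *)
pose Y : vfield M :=
  (a *: (1 : sfun M) : sfun M) *: Z 0 + (b *: (1 : sfun M) : sfun M) *: Z 1.
have XY f : X f (iota q) = Y f (iota q).
  by rewrite Xab /Y !vfE !sfunE !mulr1.
(* Writing [alpha_i] as [g(Z_i, .)] shows that it depends only on the value of its argument at the
   point. *)
have alphaX i : (alpha i X : sfun M) (iota q) = (alpha i Y : sfun M) (iota q).
  by rewrite -!gZ !(Defs.metric_sym g (Z i)); exact: metric_at.
move=> f; rewrite Xab /reeb_part !vfE !sfunE !alphaX.
rewrite -!gZ /Y !metricE !gZ !alphaZ !sfunE /=.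
by rewrite !(mulr1, mulr0, addr0, add0r).
Qed.

Context (levi_civita_nabla : is_levi_civita g nabla).
Context (nablaZ : forall i j, nabla (Z i) (Z j) = 0).

Lemma totally_geodesic_integral_surface : is_totally_geodesic nabla iota.
Proof.
have [nablaDl nablaDr nablaL _ _] := levi_civita_nabla.
move=> U X Y oU tX tY q Uq.
have vanish V : (forall r, U r -> tangent_along iota V r) ->
    vanishes_along iota U (V - reeb_part V).
  move=> tV r Ur f.
  by rewrite vfD vfN !sfunE (tangent_reeb_part (tV r Ur)) subrr.
(* The Reeb part of [X] contributes nothing by [nablaZ], and the remainder vanishes along the
   surface. *)
have nablaXZ i f : nabla X (Z i) f (iota q) = 0.
  have -> : X = (alpha 0 X : sfun M) *: Z 0 + ((alpha 1 X : sfun M) *: Z 1 +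
      (X - reeb_part X)).
    by rewrite addrA -/(reeb_part X) addrC subrK.
  rewrite !nablaDl !nablaZ !scaler0 !add0r.
  by rewrite (nabla_vanishing_direction oU levi_civita_nabla
    (tangent_reeb i q) Uq (vanish _ tX)).
have [_ _ _ span] := surface_iota.
apply/(span q (fun f => nabla X Y f (iota q))).
(* The coefficients left by the Leibniz rule on [reeb_part Y] once [nabla_X Z_j] vanishes. *)
exists ((X (alpha 0 Y : sfun M) : sfun M) (iota q)),
  ((X (alpha 1 Y : sfun M) : sfun M) (iota q)) => f.
have -> : nabla X Y = nabla X (Y - reeb_part Y) + nabla X (reeb_part Y).
  by rewrite -nablaDr subrK.
rewrite vfD sfunD (nabla_vanishing oU levi_civita_nabla
  (tX q Uq) Uq (vanish _ tY)) add0r.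
rewrite nablaDr !nablaL !vfE !sfunE !nablaXZ.
by rewrite !mulr0 !addr0.
Qed.

End IntegralSurface.

Theorem theorem13 (R : realType) (M : manifold R) (h k : nat)
    (alpha : 'I_2 -> oneform M) (Z : 'I_2 -> vfield M) (phi : endofield M)
    (g : metric M) (nabla : vfield M -> vfield M -> vfield M)
    (contact_alpha : is_contact_pair h k alpha)
    (reeb_Z : are_reeb_fields alpha Z)
    (structure_phi : is_contact_pair_structure alpha Z phi)
    (compatible_g : is_compatible g alpha phi)
    (levi_civita_nabla : is_levi_civita g nabla) :
  (forall i X, g (Z i) X = alpha i X) /\
  (forall i j, g (Z i) (Z j) = (i == j)%:R) /\
  (forall i j, nabla (Z i) (Z j) = 0) /\
  (forall i (J : set R) (c : R -> M), open J -> is_integral_curve (Z i) J c ->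
     is_geodesic nabla J c) /\
  (forall (N : manifold R) (iota : smap N M), is_orbit Z iota ->
     [/\ mdim N = 2%N, injective iota, is_immersion iota
       & is_totally_geodesic nabla iota]) /\
  (is_associated g alpha Z phi ->
     forall i, (forall X, lie_endo (Z i) phi X = 0) <-> is_killing g (Z i)).
Proof.
have [_ alphaZ _] := reeb_Z.
have gZ i X : g (Z i) X = alpha i X by exact: compatible_reeb compatible_g.
have nablaZ i j : nabla (Z i) (Z j) = 0 by exact: nabla_reeb gZ.
split; [exact: gZ|split; [by move=> i j; rewrite gZ alphaZ|]].
split; [exact: nablaZ|split; [|split]].
(* The Reeb field itself extends the velocity of its integral curve. *)
- move=> i J c oJ cJ t0 Jt0; exists (Z i).
  have : \forall t \near t0, J t by exact: open_nbhs_nbhs.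
  by apply: filterS => t Jt; split; [exact: cJ|move=> f; rewrite nablaZ].
- move=> N iota [surf _ _ _]; have [dimN inj imm _] := surf; split=> //.
  exact: totally_geodesic_integral_surface nablaZ.
- move=> assoc_g i; exact: (killing_iff_lie_endo_eq0 reeb_Z structure_phi).
Qed.
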